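(* Let $d\geq 1$ and $k\geq 1$ be integers and let $q$ be a prime power with $q\geq dk+1$. Let $x_1,\dots,x_{dk+1}$ be the first $dk+1$ elements of $\mathbb{F}_q$ in a fixed order. For $i\geq 0$ let $M_i=M_{q^{2^i},k,d}$ be the binary matrix whose rows are indexed by pairs $(x_l,y)$ with $1\le l\le dk+1$ and $y\in\mathbb{F}_{q^{2^i}}$, whose columns are indexed by polynomials $f\in\mathbb{F}_{q^{2^i}}[x]$ of degree at most $k$, with entry $1$ iff $f(x_l)=y$, where rows and columns are ordered so that those indexed by $y\in\mathbb{F}_{q^{2^{i-1}}}$ and by polynomials over $\mathbb{F}_{q^{2^{i-1}}}$ come first, in the order used for $M_{i-1}$ (here $\mathbb{F}_{q^{2^{i-1}}}\subseteq\mathbb{F}_{q^{2^i}}$). Then $(M_i)_{i\geq 0}$ is a monotone family of $d$-CFF$(t=(dk+1)q^{2^i},\, n=q^{2^i(k+1)})$. Moreover its compression ratio is $\rho(n)=n^{1-\frac{1}{k+1}}$, i.e. $n/t$ is $O(n^{1-1/(k+1)})$.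
   Context: A $d$-CFF$(t,n)$ is a set system with $t$ points and $n$ blocks in which no block is contained in the union of any $d$ other blocks, represented by its $t\times n$ binary incidence matrix (rows = points, columns = blocks). An embedding family is a sequence $(\mathcal{M}^{(l)})_l$ of incidence matrices of set systems $(X_l,\mathcal{B}_l)$, $\mathcal{M}^{(l)}$ a $d(l)$-CFF, with $X_l\subseteq X_{l+1}$, nondecreasing numbers of rows and columns, $d(l)\le d(l+1)$, and $\mathcal{M}^{(l+1)}=\begin{pmatrix}\mathcal{M}^{(l)}&Y\\ Z&W\end{pmatrix}$ for some $Y,Z,W$. A monotone family of $d$-CFFs is an embedding family with $d(l)=d$ fixed such that the block $Z$ is always a zero matrix. *)

(* Defs.v *)
From HB Require Import structures.
From mathcomp Require Import all_boot all_order all_algebra.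
From mathcomp Require Import finmap.
From mathcomp Require Import all_classical all_reals all_analysis.
Set Implicit Arguments.
Unset Strict Implicit.
Unset Printing Implicit Defensive.
Import Order.TTheory GRing.Theory Num.Theory.
Import numFieldNormedType.Exports.
Local Open Scope classical_set_scope.
Local Open Scope fset_scope.
Local Open Scope ring_scope.

Definition prime_power (q : nat) : Prop :=
  exists p m : nat, [/\ prime p, (0 < m)%N & q = (p ^ m)%N].

(* A set system is a pair (X, B) of finite sets, with X a set of points taken
   in a universe P and B a set of subsets of X. *)
Definition is_set_system (P : choiceType) (X : {fset P}) (B : {fset {fset P}}) :
    Prop :=
  forall b : {fset P}, b \in B -> b `<=` X.

Record cff (d t n : nat) (P : choiceType) (X : {fset P}) (B : {fset {fset P}}) :
    Prop := Cff {
  cff_set_system : is_set_system X B;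
  cff_points : #|` X| = t;
  cff_blocks : #|` B| = n;
  cff_cover_free : forall (b : {fset P}) (D : {fset {fset P}}),
    b \in B -> D `<=` B `\ b -> #|` D| = d ->
    ~ b `<=` \bigcup_(b' <- D) b' }.

(* Incidence matrices are taken with respect to arbitrary enumerations without
   repetition r of the points and c of the blocks. *)
Definition incidence_mx (t n : nat) (P : choiceType)
    (X : {fset P}) (B : {fset {fset P}}) (M : 'M[bool]_(t, n)) : Prop :=
  exists (r : t.-tuple P) (c : n.-tuple {fset P}),
    [/\ uniq r, r =i X, uniq c, c =i B &
        forall (i : 'I_t) (j : 'I_n), M i j = (tnth r i \in tnth c j)].

(* M' is of the form (M Y; Z W); the casts identify t + (t' - t) with t' and
   n + (n' - n) with n', which entails t <= t' and n <= n'. *)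
Definition extends_with (t n t' n' : nat)
    (M : 'M[bool]_(t, n)) (M' : 'M[bool]_(t', n'))
    (Z : 'M[bool]_(t' - t, n)) : Prop :=
  exists (et : (t + (t' - t) = t')%N) (en : (n + (n' - n) = n')%N)
         (Y : 'M[bool]_(t, n' - n)) (W : 'M[bool]_(t' - t, n' - n)),
    M' = castmx (et, en) (block_mx M Y Z W).

Record embedding_family (d t n : nat -> nat) (P : choiceType)
    (X : nat -> {fset P}) (B : nat -> {fset {fset P}})
    (M : forall l : nat, 'M[bool]_(t l, n l)) : Prop := EmbeddingFamily {
  emb_cff : forall l, cff (d l) (t l) (n l) (X l) (B l);
  emb_incidence : forall l, incidence_mx (X l) (B l) (M l);
  emb_points : forall l, X l `<=` X l.+1;
  emb_rows : forall l, (t l <= t l.+1)%N;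
  emb_cols : forall l, (n l <= n l.+1)%N;
  emb_strength : forall l, (d l <= d l.+1)%N;
  emb_block : forall l, exists Z, extends_with (M l) (M l.+1) Z }.

Definition monotone_family (d : nat) (t n : nat -> nat) (P : choiceType)
    (X : nat -> {fset P}) (B : nat -> {fset {fset P}})
    (M : forall l : nat, 'M[bool]_(t l, n l)) : Prop :=
  embedding_family (fun _ => d) X B M /\
  forall l Z, extends_with (M l) (M l.+1) Z -> Z = const_mx false.

Definition has_compression_ratio (R : realType) (t n : nat -> nat)
    (M : forall l : nat, 'M[bool]_(t l, n l)) (rho : R -> R) : Prop :=
  (fun l : nat => (n l)%:R / (t l)%:R : R) =O_\oo
  (fun l : nat => rho (n l)%:R).

(* F_0 <= F_1 <= ... are finite fields with q^(2^i) elements, realised inside a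
   common ambient field L, so that the inclusions are genuine inclusions. *)
Record finite_field_tower (q : nat) (L : fieldType) (F : nat -> {fset L}) :
    Prop := FiniteFieldTower {
  tower_subfield : forall i, divring_closed (mem (F i));
  tower_card : forall i, #|` F i| = (q ^ 2 ^ i)%N;
  tower_incl : forall i, F i `<=` F i.+1 }.

Section PolynomialMatrix.
Variables (L : fieldType) (k : nat) (xs : seq L) (K : {fset L}).

Definition row_order (r : seq (L * L)) : Prop :=
  uniq r /\ forall x y : L, ((x, y) \in r) = (x \in xs) && (y \in K).

Definition col_order (c : seq {poly L}) : Prop :=
  uniq c /\ forall f : {poly L},
    (f \in c) = (f \is a polyOver (mem K)) && (size f <= k.+1)%N.

Definition poly_mx (r : seq (L * L)) (c : seq {poly L}) :
    'M[bool]_(size r, size c) :=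
  \matrix_(i, j) ((tnth (in_tuple c) j).[(tnth (in_tuple r) i).1]
                    == (tnth (in_tuple r) i).2).

Definition poly_points : {fset L * L} := [fset x in xs] `*` K.

Definition poly_blocks (c : seq {poly L}) : {fset {fset L * L}} :=
  [fset [fset (x, f.[x]) | x in xs] | f in c].

End PolynomialMatrix.

(* Main.v *)
Require Import Defs.
From HB Require Import structures.
From mathcomp Require Import all_boot all_order all_algebra.
From mathcomp Require Import finmap.
From mathcomp Require Import all_classical all_reals all_analysis.
Set Implicit Arguments.
Unset Strict Implicit.
Unset Printing Implicit Defensive.
Import Order.TTheory GRing.Theory Num.Theory.
Import numFieldNormedType.Exports.
Local Open Scope ring_scope.


(** The column of [f] is the graph of [f] over [xs]. Distinct polynomials of degree at most [k]
    agree at no more than [k] points ([size_agreement]), so [d] other graphs meet that of [f] in at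
    most [d * k] points, fewer than the [d * k + 1] it has ([graph_cover_free]).

    An entry depends only on the pair and the polynomial, not on the field, so extending the
    enumerations of rows and columns keeps the old matrix as top left block ([poly_mx_extends]). The
    points of [xs] lie in the bottom field, so a polynomial over [F i] takes its values in [F i]
    there, while each new row has its second coordinate outside [F i]; hence the lower left block
    vanishes ([poly_mx_extends0]).

    With Q = q^(2^i) there are (d k + 1) Q rows and Q^(k+1) columns, so n / t = Q^k / (d k + 1),
    while n^(1 - 1/(k+1)) = Q^k. *)

Section BlockForm.
Variables (t n t' n' : nat) (M : 'M[bool]_(t, n)) (M' : 'M[bool]_(t', n')).

Lemma exists_extends_with (ht : (t <= t')%N) (hn : (n <= n')%N) :
  (forall i j, M' (widen_ord ht i) (widen_ord hn j) = M i j) ->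
  exists Z, extends_with M M' Z.
Proof.
move=> hM; have et := subnKC ht; have en := subnKC hn.
pose N := castmx (esym et, esym en) M'.
exists (dlsubmx N), et, en, (ursubmx N), (drsubmx N).
have -> : M = ulsubmx N.
  apply/matrixP => i j; rewrite -hM !mxE castmxE /=.
  by congr (M' _ _); apply: val_inj.
by rewrite submxK /N castmxKV.
Qed.

(** Monotonicity quantifies over every admissible [Z]; this reads any such [Z] off [M'], hiding the
    casts behind an equality of indices. *)
Lemma extends_with_entry (Z : 'M[bool]_(t' - t, n)) (ht : (t <= t')%N)
    (hn : (n <= n')%N) : extends_with M M' Z ->
  forall (i : 'I_(t' - t)) (j : 'I_n),
  exists2 i' : 'I_t', i' = (t + i)%N :> nat &
    Z i j = M' i' (widen_ord hn j).
Proof.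
move=> [et [en [Y [W ->]]]] i j; exists (cast_ord et (rshift t i)) => //.
rewrite castmxE cast_ordK.
have -> : cast_ord (esym en) (widen_ord hn j) = lshift (n' - n) j.
  exact: val_inj.
by rewrite block_mxEdl.
Qed.

End BlockForm.

(** The enumerations inside an incidence matrix already count points and blocks, which supplies the
    two cardinality fields of [cff]. *)
Lemma card_incidence (t n : nat) (P : choiceType) (X : {fset P})
    (B : {fset {fset P}}) (M : 'M[bool]_(t, n)) :
  incidence_mx X B M -> #|` X|%fset = t /\ #|` B|%fset = n.
Proof.
move=> [r [c [ur rX uc cB _]]]; split.
  rewrite -(size_tuple r); apply: perm_size.
  by apply: uniq_perm; rewrite ?fset_uniq.
rewrite -(size_tuple c); apply: perm_size.
by apply: uniq_perm; rewrite ?fset_uniq.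
Qed.

Section PolynomialMatrixTheory.
Variables (L : fieldType) (K : {fset L}) (xs : seq L).

Lemma divring_closed_fset0 : divring_closed (mem K) -> 0 \in K.
Proof. by case=> h1 hB _; rewrite -(subrr 1); apply: hB. Qed.

(** Beyond the size of [f] the coefficients default to 0, whence the condition on [K]. *)
Lemma polyOver_fsetP (f : {poly L}) : 0 \in K ->
  reflect (forall i, f`_i \in K) (f \is a polyOver (mem K)).
Proof.
move=> K0; apply: (iffP (all_nthP 0)) => h i; last by move=> _; apply: h.
have [lt_i|ge_i] := ltnP i (size f); first exact: h.
by rewrite nth_default.
Qed.

Lemma fset_horner (f : {poly L}) (x : L) : divring_closed (mem K) ->
  f \is a polyOver (mem K) -> x \in K -> f.[x] \in K.
Proof.
move=> hK fK xK.
(* Packing [K] as a divring-closed predicate makes the generic closure of subrings under evaluation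
   applicable. *)
pose S : divringClosed L :=
  HB.pack (mem K : L -> bool) (GRing.isDivringClosed.Build L _ hK).
exact: (@rpred_horner _ S).
Qed.

Lemma size_row_order (r : seq (L * L)) : uniq xs -> row_order xs K r ->
  size r = (size xs * #|` K|)%N.
Proof.
move=> uxs [ur hr].
rewrite -(size_allpairs (fun x y => (x, y))); apply: perm_size.
apply: uniq_perm => //.
  by apply: allpairs_uniq => // -[x y] [x' y'] _ _.
move=> [x y]; rewrite hr; apply/andP/allpairsP => [[hx hy]|].
  by exists (x, y).
by move=> [[x' y'] [/= hx hy [-> ->]]].
Qed.

Lemma size_col_order (k : nat) (c : seq {poly L}) : 0 \in K ->
  col_order k K c -> size c = (#|` K| ^ k.+1)%N.
Proof.
move=> K0 [uc hc].
pose P (g : {ffun 'I_k.+1 -> K}) : {poly L} :=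
  \poly_(i < k.+1) val (g (inord i)).
have -> : (#|` K| ^ k.+1)%N = size [seq P g | g <- enum {ffun 'I_k.+1 -> K}].
  by rewrite size_map -cardE card_ffun card_ord -cardfE.
apply: perm_size; apply: uniq_perm => //.
  rewrite map_inj_uniq ?enum_uniq// => g g' /polyP eP.
  apply/ffunP => i; apply: val_inj; have := eP i.
  by rewrite !coef_poly ltn_ord inord_val.
move=> f; rewrite hc; apply/andP/mapP => [[/polyOver_fsetP fK szf]|].
  (* The default of [insubd] is never reached, since every coefficient lies in [K]. *)
  exists [ffun i : 'I_k.+1 => insubd [` K0]%fset f`_i].
    by rewrite mem_enum.
  apply/polyP => i; rewrite coef_poly; case: ltnP => [lti|gei].
    by rewrite ffunE val_insubd fK// inordK.
  by rewrite nth_default// (leq_trans szf).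
move=> [g _ ->]; split; last exact: size_poly.
apply/polyOver_fsetP => // i; rewrite coef_poly.
by case: ifP => // _; apply: valP.
Qed.

Lemma mem_graph (f : {poly L}) (x y : L) :
  ((x, y) \in [fset (x, f.[x]) | x in xs]%fset) = (x \in xs) && (y == f.[x]).
Proof.
apply/imfsetP/andP => [[x' hx' [-> ->]]|[hx /eqP ->]]; first by [].
by exists x.
Qed.

Hypothesis uxs : uniq xs.

(** The points of agreement are distinct roots of the nonzero polynomial [f - g], of degree at most
    [k]. *)
Lemma size_agreement (k : nat) (f g : {poly L}) :
  (size f <= k.+1)%N -> (size g <= k.+1)%N -> f != g ->
  (size [seq x <- xs | f.[x] == g.[x]] <= k)%N.
Proof.
move=> sf sg nfg; rewrite -ltnS.
apply: (@leq_trans (size (f - g))); last first.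
  by rewrite (leq_trans (size_polyD _ _))// geq_max sf size_polyN.
apply: max_poly_roots; rewrite ?subr_eq0 ?filter_uniq//.
apply/allP => x; rewrite mem_filter => /andP[/eqP efg _].
by rewrite /root !hornerE efg subrr.
Qed.

(** Equal graphs mean agreement on all of [xs], more than [k] points. This makes the columns
    pairwise distinct blocks. *)
Lemma graph_inj (k : nat) (f g : {poly L}) :
  (k < size xs)%N -> (size f <= k.+1)%N -> (size g <= k.+1)%N ->
  [fset (x, f.[x]) | x in xs]%fset = [fset (x, g.[x]) | x in xs]%fset -> f = g.
Proof.
move=> kxs sf sg efg; apply/eqP; apply: contraLR kxs => nfg; rewrite -leqNgt.
rewrite -(all_filterP (a := fun x => f.[x] == g.[x]) (s := xs) _).
  exact: size_agreement.
apply/allP => x hx; have := mem_graph f x f.[x].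
by rewrite efg mem_graph hx eqxx.
Qed.

(* Each of the d other graphs meets the graph of f in at most k points, too few
   to cover its d k + 1 points. *)
Lemma graph_cover_free (d k : nat) (c : seq {poly L}) (b : {fset L * L})
    (D : {fset {fset L * L}}) :
  (d * k < size xs)%N -> (forall f, f \in c -> (size f <= k.+1)%N) ->
  b \in poly_blocks xs c -> (D `<=` poly_blocks xs c `\ b)%fset ->
  #|` D| = d -> ~ (b `<=` \bigcup_(b' <- D) b')%fset.
Proof.
move=> dk sc /imfsetP[f /= fc ->{b}] /fsubsetP sD cD /fsubsetP cov.
move: dk; apply/negP; rewrite -leqNgt.
(* Block by block, [s] lists the abscissae where the graph of [f] is met. A cover forces every
   element of [xs] into [s], yet each of the [d] chunks has length at most [k]. *)
pose s := flatten [seq [seq x <- xs | (x, f.[x]) \in (b' : {fset L * L})]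
                  | b' <- D].
apply: (@leq_trans (size s)).
  apply: uniq_leq_size => // x hx.
  have /bigfcupP[b' /andP[b'D _] xb'] :
      (x, f.[x]) \in (\bigcup_(b' <- D) b')%fset.
    by apply: cov; rewrite mem_graph hx eqxx.
  apply/flattenP; exists [seq x <- xs | (x, f.[x]) \in b'].
    by apply/mapP; exists b'.
  by rewrite mem_filter xb'.
rewrite size_flatten sumnE !big_map -cD -[leqRHS]/(size D * k)%N.
(* Membership in [D] is kept as a side condition: it is what makes [b'] the graph of some [g] other
   than [f]. *)
rewrite big_seq_cond.
apply: (@leq_trans (\sum_(b' <- D | (b' \in D) && true) k)%N).
  apply: leq_sum => b'; rewrite andbT => /sD; rewrite !inE => /andP[nb].
  move=> /imfsetP[g /= gc eb]; have := nb; rewrite eb => nfg.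
  rewrite (eq_in_filter (a2 := fun x => f.[x] == g.[x])).
    apply: size_agreement; rewrite ?sc//.
    by apply: contraNneq nfg => ->.
  by move=> x hx; rewrite mem_graph hx.
by rewrite -big_seq_cond big_const_seq count_predT iter_addn_0 mulnC.
Qed.

Lemma poly_mx_incidence (k : nat) (r : seq (L * L)) (c : seq {poly L}) :
  (k < size xs)%N -> row_order xs K r -> col_order k K c ->
  incidence_mx (poly_points xs K) (poly_blocks xs c) (poly_mx r c).
Proof.
move=> kxs [ur hr] [uc hc].
pose G (f : {poly L}) := [fset (x, f.[x]) | x in xs]%fset.
exists (in_tuple r), (map_tuple G (in_tuple c)); split => //.
- by move=> [x y]; rewrite hr in_fsetM inE.
- rewrite map_inj_in_uniq// => f g.
  by rewrite !hc => /andP[_ sf] /andP[_ sg]; apply: graph_inj kxs sf sg.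
- by move=> b; apply/mapP/imfsetP => -[f fc ->]; exists f.
- move=> i j; rewrite mxE tnth_map; have := mem_tnth i (in_tuple r).
  case: (tnth (in_tuple r) i) => x y; rewrite hr => /andP[hx _] /=.
  by rewrite mem_graph hx eq_sym.
Qed.

Lemma poly_mx_cff (d k : nat) (r : seq (L * L)) (c : seq {poly L}) :
  {subset xs <= K} -> divring_closed (mem K) ->
  (d * k < size xs)%N -> (k < size xs)%N ->
  row_order xs K r -> col_order k K c ->
  cff d (size r) (size c) (poly_points xs K) (poly_blocks xs c).
Proof.
move=> xsK hK dk kxs hr hc.
have [cardX cardB] := card_incidence (poly_mx_incidence kxs hr hc).
have cP f : f \in c -> (f \is a polyOver (mem K)) /\ (size f <= k.+1)%N.
  by rewrite (proj2 hc) => /andP.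
split=> //.
- move=> b /imfsetP[f /cP[fK _] ->]; apply/fsubsetP => -[x y].
  rewrite mem_graph => /andP[hx /eqP ->]; rewrite in_fsetM /= inE hx /=.
  by apply: fset_horner => //; apply: xsK.
- by move=> b D; apply: graph_cover_free dk _ => f /cP[].
Qed.

End PolynomialMatrixTheory.

Section Prefix.
Variables (T : eqType) (s s' : seq T).
Hypothesis ss' : prefix s s'.

Lemma prefix_size : (size s <= size s')%N.
Proof. by case/prefixP: ss' => u ->; rewrite size_cat leq_addr. Qed.

Lemma tnth_prefix (i : 'I_(size s)) (i' : 'I_(size s')) : i' = i :> nat ->
  tnth (in_tuple s') i' = tnth (in_tuple s) i.
Proof.
move=> ii'; have x0 := tnth (in_tuple s) i; rewrite !(tnth_nth x0) /= ii'.
by case/prefixP: ss' => u ->; rewrite nth_cat ltn_ord.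
Qed.

Lemma tnth_notin_prefix (i' : 'I_(size s')) : uniq s' -> (size s <= i')%N ->
  tnth (in_tuple s') i' \notin s.
Proof.
move=> us' si'; have x0 := tnth (in_tuple s') i'; rewrite (tnth_nth x0) /=.
move: (val i') (ltn_ord i') si' us' => n lti' sn.
case/prefixP: ss' lti' => u ->; rewrite cat_uniq size_cat nth_cat.
rewrite [(n < size s)%N]ltnNge sn /= => lt_n /and3P[_ /hasPn hu _].
by apply: hu; rewrite mem_nth// ltn_subLR.
Qed.

End Prefix.

Section Embedding.
Variables (L : fieldType) (k : nat) (xs : seq L) (K K' : {fset L}).
Variables (r r' : seq (L * L)) (c c' : seq {poly L}).
Hypotheses (hr : row_order xs K r) (hr' : row_order xs K' r').
Hypotheses (hc : col_order k K c).
Hypotheses (rr' : prefix r r') (cc' : prefix c c').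

Lemma poly_mx_extends : exists Z, extends_with (poly_mx r c) (poly_mx r' c') Z.
Proof.
apply: (exists_extends_with (ht := prefix_size rr') (hn := prefix_size cc')) => i j.
rewrite !mxE (tnth_prefix rr' (i := i))// (tnth_prefix cc' (i := j))//.
Qed.

(* A polynomial over K only takes values in K at points of K, whereas the rows
   added to r are indexed by pairs (x, y) with y outside K. *)
Lemma poly_mx_extends0 Z : {subset xs <= K} -> divring_closed (mem K) ->
  extends_with (poly_mx r c) (poly_mx r' c') Z -> Z = const_mx false.
Proof.
move=> xsK hK /extends_with_entry.
move=> /(_ (prefix_size rr') (prefix_size cc')) hZ; apply/matrixP => i j.
have [i' ei' ->] := hZ i j; rewrite !mxE (tnth_prefix cc' (i := j))//.
have := tnth_notin_prefix rr' (i' := i') (proj1 hr').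
rewrite ei' leq_addr => /(_ isT).
have := mem_tnth i' (in_tuple r').
case: (tnth (in_tuple r') i') => x y.
(* Since [x] is in [xs], the pair can be missing from [r] only because [y] is outside [K]. *)
rewrite (proj2 hr') (proj2 hr) => /andP[hx _]; rewrite hx /=.
apply: contraNF => /eqP <-.
have := mem_tnth j (in_tuple c); rewrite (proj2 hc) => /andP[fK _].
by apply: fset_horner => //; apply: xsK.
Qed.

End Embedding.

(** The exponents multiply to (k + 1)(1 - 1/(k + 1)) = k; applied with [a] the field size, so that
    [a ^+ k.+1] is the number of columns. *)
Lemma powR_expn_root (R : realType) (a : R) (k : nat) : 0 <= a ->
  (a ^+ k.+1) `^ (1 - 1 / k.+1%:R) = a ^+ k.
Proof.
move=> a0; rewrite -!powR_mulrn// -powRrM; congr (_ `^ _).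
by rewrite mulrBr mulr1 mulrCA mulfV ?mulr1 ?pnatr_eq0// mulrSr addrK.
Qed.

Theorem theorem5 (R : realType) (d k q : nat)
  (hd : (1 <= d)%N) (hk : (1 <= k)%N)
  (hq : prime_power q) (hqdk : (d * k + 1 <= q)%N)
  (L : fieldType) (F : nat -> {fset L}) (hF : finite_field_tower q F)
  (e : seq L) (he : uniq e) (heF : e =i F 0%N)
  (xs : seq L) (hxs : xs = take (d * k + 1) e)
  (rows : nat -> seq (L * L)) (cols : nat -> seq {poly L})
  (hrows : forall i : nat, row_order xs (F i) (rows i))
  (hcols : forall i : nat, col_order k (F i) (cols i))
  (hrows_first : forall i : nat, prefix (rows i) (rows i.+1))
  (hcols_first : forall i : nat, prefix (cols i) (cols i.+1)) :
  let M := fun i : nat => poly_mx (rows i) (cols i) in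
  [/\ monotone_family d (fun i : nat => poly_points xs (F i))
        (fun i : nat => poly_blocks xs (cols i)) M,
      forall i : nat, size (rows i) = ((d * k + 1) * q ^ 2 ^ i)%N,
      forall i : nat, size (cols i) = (q ^ (2 ^ i * (k + 1)))%N &
      has_compression_ratio M
        (fun n : R => n `^ (1 - 1 / (k + 1)%:R))].
Proof.
have K0 i : 0 \in F i by apply/divring_closed_fset0/(tower_subfield hF).
have F0F i : {subset F 0%N <= F i}.
  elim: i => [//|i IH] x /IH; exact/fsubsetP/(tower_incl hF).
have uxs : uniq xs by rewrite hxs take_uniq.
have sxs : size xs = (d * k + 1)%N.
  rewrite hxs size_takel//; suff -> : size e = q by [].
  (* The bottom field has q^(2^0) = q elements, so [take] finds the [d * k + 1] it asks for. *)
  rewrite -[RHS]expn1 -[1%N](expn0 2) -(tower_card hF).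
  by apply: perm_size; apply: uniq_perm; rewrite ?fset_uniq.
have xsF i : {subset xs <= F i}.
  by move=> x; rewrite hxs => /mem_take; rewrite heF => /F0F.
have dk : (d * k < size xs)%N by rewrite sxs addn1.
(* Here [1 <= d] enters, giving [k <= d * k]. *)
have kxs : (k < size xs)%N by rewrite (leq_ltn_trans _ dk)// leq_pmull.
have szr i : size (rows i) = ((d * k + 1) * q ^ 2 ^ i)%N.
  by rewrite (size_row_order uxs (hrows i)) sxs (tower_card hF).
have szc i : size (cols i) = (q ^ (2 ^ i * (k + 1)))%N.
  by rewrite (size_col_order (K0 i) (hcols i)) (tower_card hF) -expnM addn1.
have Fring i := tower_subfield hF i.
move=> M; split=> //.
- split=> [|l Z].
    split=> l.
    + exact: (poly_mx_cff uxs (xsF l) (Fring l) dk kxs (hrows l) (hcols l)).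
    + exact: (poly_mx_incidence uxs kxs (hrows l) (hcols l)).
    + apply/fsubsetP => -[x y]; rewrite !in_fsetM => /andP[-> /=].
      exact/fsubsetP/(tower_incl hF).
    + exact: prefix_size.
    + exact: prefix_size.
    + exact: leqnn.
    + exact: poly_mx_extends.
  exact: (poly_mx_extends0 (hrows l) (hrows l.+1) (hcols l)).
(* The constant 1 suffices at every level, since Q^k / (d k + 1) is at most Q^k. *)
- rewrite /has_compression_ratio; apply/eqO_exP; exists 1 => //.
  apply: nearW => l /=; rewrite mul1r szr szc.
  set Q : R := (q ^ 2 ^ l)%:R.
  have Q0 : 0 < Q.
    by rewrite ltr0n expn_gt0 (leq_trans _ hqdk)// addn1.
  rewrite expnM natrX addn1 -/Q (powR_expn_root _ (ltW Q0)).
  rewrite !ger0_norm ?divr_ge0 ?exprn_ge0 ?ler0n ?(ltW Q0)// natrM -/Q.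
  rewrite ler_pdivrMr; last by rewrite mulr_gt0// ltr0n addn1.
  by rewrite exprSr ler_pM2l ?exprn_gt0// ler_peMl ?(ltW Q0)// addn1 ler1n.
Qed.
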